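(* Let $t_0<T$ be fixed, let $x_0\in\mathbb{R}^n$, let $E$ be a finite nonempty index set, and let $\Phi^k$, $k\in E$, be continuously differentiable real-valued functions of $(x,t)\in\mathbb{R}^n\times\mathbb{R}$. Consider the optimal control problem described in the context whose only terminal constraints are the equalities $\Phi^k(x(T),T)=0$, $k\in E$ (no inequality constraints), and let $(x^*,u^* )$ be an optimal pair, $z^*=\dot x^*$. Suppose that the gradients $\nabla\Phi^k(x^*(T),T)$, $k\in E$, are linearly independent (LICQ). Then there exist a neighborhood $B$ of $(z^*,u^* )$ and a constant $a>0$ such that for all $(z,u)\in B$ with $\phi_{\mathrm{term}}(z)>0$, $$\operatorname{dist}\bigl(0,\partial\phi_{\mathrm{term}}(z)\bigr)\ge a .$$
   Context: Setting: minimize $\Phi^0(x(T),T)$, with $\Phi^0$ continuously differentiable, over controls $u\in U$ and states $x$ subject to $\dot x(t)=f(x(t),u(t),t)$ on $[t_0,T]$, $x(t_0)=x_0$, and the terminal constraints. Here $U$ is the set of piecewise continuous $u:[t_0,T]\to\mathbb{R}^m$ with values in a compact set $V\subset\mathbb{R}^m$, and $x:[t_0,T]\to\mathbb{R}^n$ is piecewise continuously differentiable. The map $f$ is differentiable in $x$, Lipschitz in $x$ uniformly in $(u,t)$, and $f$ and $\partial f/\partial x$ are continuous in all arguments. In particular an optimal pair satisfies $\Phi^k(x^*(T),T)=0$ for all $k\in E$. The state is parametrized by its derivative $z=\dot x$ (piecewise continuous, $\mathbb{R}^n$-valued on $[t_0,T]$): $x(t)=x_0+\int_{t_0}^t z(\tau)\,d\tau$,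 and $x_T=x_0+\int_{t_0}^T z(t)\,dt$. Pairs $(z,u)$ are considered with the $L_2\times L_2$ topology. The terminal penalty is $$\phi_{\mathrm{term}}(z)=\max_{k\in E}|\Phi^k(x_T,T)| .$$ Gradients $\nabla\Phi^k$ are taken with respect to the spatial variable $x$. For $\phi_{\mathrm{term}}(z)>0$, with $E_{\mathrm{act}}(z)=\{k\in E: |\Phi^k(x_T,T)|=\phi_{\mathrm{term}}(z)\}$, the subdifferential is $$\partial\phi_{\mathrm{term}}(z)=\operatorname{co}\{\operatorname{sign}(\Phi^k(x_T,T))\,\nabla\Phi^k(x_T,T): k\in E_{\mathrm{act}}(z)\}\subset\mathbb{R}^n,$$ where $\operatorname{co}$ is the convex hull. (A vector of $\mathbb{R}^n$ is identified with the corresponding constant function in $L_2$; distance is Euclidean distance in $\mathbb{R}^n$.) *)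

(* Defs.v *)
From HB Require Import structures.
From mathcomp Require Import all_boot all_order all_algebra.
From mathcomp Require Import all_classical all_reals all_analysis.

Set Implicit Arguments.
Unset Strict Implicit.
Unset Printing Implicit Defensive.

Import Order.TTheory GRing.Theory Num.Theory.
Import numFieldNormedType.Exports.

Local Open Scope classical_set_scope.
Local Open Scope ring_scope.

(* Vectors of R^n are row vectors 'rV[R]_n, and the
   functions on [a, b] are total functions on R of which only the values on
   [a, b] matter.  The library norm on 'rV[R]_n is the max norm: it is only used
   where the choice of a norm is immaterial (topology, differentiability,
   existence of a Lipschitz constant). *)

Definition enorm (R : realType) (n : nat) (v : 'rV[R]_n) : R :=
  Num.sqrt (\sum_(i < n) v ord0 i ^+ 2).

Definition euclid_dist (R : realType) (n : nat) (x : 'rV[R]_n) (A : set 'rV[R]_n) : R :=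
  inf [set enorm (v - x) | v in A].

Definition convex_hull (R : realType) (n : nat) (A : set 'rV[R]_n) :
    set 'rV[R]_n :=
  smallest (@convex_set R 'rV[R]_n) A.

(* Continuity of the derivative is stated pointwise on vectors; in finite
   dimension this is continuity in the operator norm. *)
Definition C1 (R : realType) (n : nat) (F : 'rV[R]_n * R -> R) : Prop :=
  (forall p, differentiable F p) /\
  (forall v, continuous (fun p => 'd F p v)).

Definition grad_x (R : realType) (n : nat) (F : 'rV[R]_n * R -> R)
    (x : 'rV[R]_n) (t : R) : 'rV[R]_n :=
  \row_(i < n) 'D_(delta_mx ord0 i) (fun y => F (y, t)) x.

(* The values of g at a, at b and at the points of S are unconstrained. *)
Definition piecewise_continuous (R : realType) (n : nat) (a b : R)
    (g : R -> 'rV[R]_n) : Prop :=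
  [/\ exists2 S : set R, finite_set S &
        forall t, t \in `]a, b[ -> ~ S t -> {for t, continuous g},
      forall t, t \in `[a, b[ -> cvg (g @ t^'+) &
      forall t, t \in `]a, b] -> cvg (g @ t^'-)].

(* A piecewise continuously differentiable function is meant to be continuous,
   so that it is the integral of its derivative. *)
Definition piecewise_derivative (R : realType) (n : nat) (a b : R)
    (x z : R -> 'rV[R]_n) : Prop :=
  [/\ {within `[a, b], continuous x},
      piecewise_continuous a b z &
      exists2 S : set R, finite_set S &
        forall t, t \in `]a, b[ -> ~ S t -> is_derive t 1 x (z t)].

Definition piecewise_C1 (R : realType) (n : nat) (a b : R)
    (x : R -> 'rV[R]_n) : Prop :=
  exists z, piecewise_derivative a b x z.

Definition control (R : realType) (m : nat) (V : set 'rV[R]_m) (a b : R)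
    (u : R -> 'rV[R]_m) : Prop :=
  piecewise_continuous a b u /\ forall t, t \in `[a, b] -> V (u t).

Definition regular_dynamics (R : realType) (n m : nat) (V : set 'rV[R]_m)
    (a b : R) (f : 'rV[R]_n -> 'rV[R]_m -> R -> 'rV[R]_n) : Prop :=
  let dom := [set p : 'rV[R]_n * 'rV[R]_m * R | V p.1.2 /\ p.2 \in `[a, b]] in
  [/\ forall x u t, V u -> t \in `[a, b] -> differentiable (fun y => f y u t) x,
      exists L : R, forall u t, V u -> t \in `[a, b] ->
        L.-lipschitz (fun x => f x u t),
      {within dom, continuous (fun p => f p.1.1 p.1.2 p.2)} &
      {within dom, continuous
        (fun p => 'J (fun y => f y p.1.2 p.2) p.1.1)}].

Section ControlProblem.
Context (R : realType) (n m : nat) (V : set 'rV[R]_m) (t0 T : R)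
  (x0 : 'rV[R]_n) (f : 'rV[R]_n -> 'rV[R]_m -> R -> 'rV[R]_n)
  (E : finType) (Phi0 : 'rV[R]_n * R -> R) (Phi : E -> 'rV[R]_n * R -> R).

(* The differential equation is not imposed at finitely many times, where the
   derivative of x may fail to exist. *)
Definition admissible (x : R -> 'rV[R]_n) (u : R -> 'rV[R]_m) : Prop :=
  [/\ piecewise_C1 t0 T x /\ control V t0 T u,
      x t0 = x0,
      exists2 S : set R, finite_set S &
        forall t, t \in `]t0, T[ -> ~ S t -> is_derive t 1 x (f (x t) (u t) t) &
      forall k, Phi k (x T, T) = 0].

Definition optimal (x : R -> 'rV[R]_n) (u : R -> 'rV[R]_m) : Prop :=
  admissible x u /\
  forall y v, admissible y v -> Phi0 (x T, T) <= Phi0 (y T, T).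

Definition endpoint (z : R -> 'rV[R]_n) : 'rV[R]_n :=
  x0 + \row_(i < n) \int[lebesgue_measure]_(t in `[t0, T]) z t ord0 i.

(* The base value 0 of the iterated maximum is harmless: E will be nonempty and
   the terms are nonnegative. *)
Definition phi_term (z : R -> 'rV[R]_n) : R :=
  \big[Num.max/0]_(k : E) `|Phi k (endpoint z, T)|.

Definition E_act (z : R -> 'rV[R]_n) : set E :=
  [set k | `|Phi k (endpoint z, T)| = phi_term z].

Definition subdiff_phi_term (z : R -> 'rV[R]_n) : set 'rV[R]_n :=
  convex_hull [set Num.sg (Phi k (endpoint z, T)) *: grad_x (Phi k) (endpoint z) T
              | k in E_act z].

Definition L2norm (p : nat) (g : R -> 'rV[R]_p) : \bar R :=
  'N[lebesgue_measure]_2%:E[(fun t => (enorm (g t))%:E) \_ `[t0, T]].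

Definition pair_space : set ((R -> 'rV[R]_n) * (R -> 'rV[R]_m)) :=
  [set w | piecewise_continuous t0 T w.1 /\ control V t0 T w.2].

Definition L2_neighborhood (w0 : (R -> 'rV[R]_n) * (R -> 'rV[R]_m))
    (B : set ((R -> 'rV[R]_n) * (R -> 'rV[R]_m))) : Prop :=
  B `<=` pair_space /\
  exists2 e : R, 0 < e & forall w, pair_space w ->
    (L2norm (w.1 \- w0.1)%R < e%:E)%E -> (L2norm (w.2 \- w0.2)%R < e%:E)%E -> B w.

End ControlProblem.

(* Main.v *)
(** By LICQ the gradients [g k] at the optimal endpoint have a dual family [d],
    [<g k, d l> = (k == l)].  The gradients depend continuously on the endpoint,
    so near it [<g k, d l>] stays within [1 / (2 #|E|)] of [k == l].  Hence, for
    any signs [s], the single vector [w = \sum_l s l *: d l] satisfies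
    [<s k *: g k, w> >= 1 / 2] for all [k]; this half-space is convex, so it
    contains the subdifferential, whose distance to 0 is at least [1 / (2 |w|)],
    and [|w|] is bounded independently of [s].  The endpoint is a continuous
    function of the derivative in L2. *)
Require Import Defs.
From HB Require Import structures.
From mathcomp Require Import all_boot all_order all_algebra.
From mathcomp Require Import all_classical all_reals all_analysis.
From mathcomp Require Import measurable_realfun ring lra.

Set Implicit Arguments.
Unset Strict Implicit.
Unset Printing Implicit Defensive.

Import Order.TTheory GRing.Theory Num.Theory.
Import numFieldNormedType.Exports.

Local Open Scope classical_set_scope.
Local Open Scope ring_scope.

(** * Inner product, Euclidean norm and dual families *)

Definition dotp (R : realType) (n : nat) (v w : 'rV[R]_n) : R :=
  \sum_(i < n) v ord0 i * w ord0 i.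

Lemma dotpDl (R : realType) (n : nat) (u v w : 'rV[R]_n) :
  dotp (u + v) w = dotp u w + dotp v w.
Proof. by rewrite -big_split; apply: eq_bigr => i _; rewrite mxE mulrDl. Qed.

Lemma dotpZl (R : realType) (n : nat) (a : R) (v w : 'rV[R]_n) :
  dotp (a *: v) w = a * dotp v w.
Proof. by rewrite mulr_sumr; apply: eq_bigr => i _; rewrite mxE mulrA. Qed.

Lemma dotp_sumr (R : realType) (n : nat) (I : finType) (a : I -> R)
    (v : 'rV[R]_n) (d : I -> 'rV[R]_n) :
  dotp v (\sum_l a l *: d l) = \sum_l a l * dotp v (d l).
Proof.
under [RHS]eq_bigr do rewrite mulr_sumr.
rewrite exchange_big; apply: eq_bigr => i _ /=.
rewrite summxE mulr_sumr; apply: eq_bigr => l _.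
by rewrite mxE mulrCA.
Qed.

Lemma enorm_ge0 (R : realType) (n : nat) (v : 'rV[R]_n) : 0 <= enorm v.
Proof. exact: sqrtr_ge0. Qed.

Lemma enorm_sqr (R : realType) (n : nat) (v : 'rV[R]_n) :
  enorm v ^+ 2 = \sum_(i < n) v ord0 i ^+ 2.
Proof. by rewrite sqr_sqrtr// sumr_ge0// => i _; exact: sqr_ge0. Qed.

Lemma le_coord_enorm (R : realType) (n : nat) (v : 'rV[R]_n) (i : 'I_n) :
  `|v ord0 i| <= enorm v.
Proof.
rewrite -(@ler_pXn2r _ 2)// ?nnegrE ?enorm_ge0//.
rewrite real_normK ?num_real// enorm_sqr (bigD1 i)//= lerDl.
by rewrite sumr_ge0// => j _; exact: sqr_ge0.
Qed.

(** A crude Cauchy-Schwarz: the l1 norm of [w] replaces its Euclidean norm because it is easily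
    bounded uniformly in the signs. *)
Lemma dotp_le_enorm (R : realType) (n : nat) (v w : 'rV[R]_n) :
  dotp v w <= enorm v * \sum_(i < n) `|w ord0 i|.
Proof.
rewrite mulr_sumr; apply: ler_sum => i _.
by rewrite (le_trans (ler_norm _))// normrM ler_wpM2r// le_coord_enorm.
Qed.

(** Each coordinate form [coord] of a free family is linear on the whole space, not only on the
    span; [d l] lists its values on the standard basis. *)
Lemma dual_family (R : realType) (n : nat) (E : finType) (g : E -> 'rV[R]_n) :
  free [seq g k | k : E] ->
  exists d : E -> 'rV[R]_n, forall k l, dotp (g k) (d l) = (k == l)%:R.
Proof.
set X := [seq g k | k : E] => freeX.
have rkP (k : E) : (enum_rank k < size X)%N by rewrite size_image ltn_ord.
exists (fun l => \row_j coord (in_tuple X) (Ordinal (rkP l)) (delta_mx 0 j)).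
move=> k l.
have -> : (k == l)%:R = coord (in_tuple X) (Ordinal (rkP l)) (g k) :> R.
  have -> : g k = X`_(Ordinal (rkP k)).
    by rewrite /= nth_image enum_rankK.
  rewrite (@coord_free _ _ _ (in_tuple X))//.
  by rewrite -(inj_eq enum_rank_inj).
rewrite [in RHS](row_sum_delta (g k)) linear_sum; apply: eq_bigr => j _.
by rewrite linearZ mxE.
Qed.

Lemma convex_hull_halfspace (R : realType) (n : nat) (A : set 'rV[R]_n)
    (w : 'rV[R]_n) (c : R) :
  (forall v, A v -> c <= dotp v w) ->
  forall v, convex_hull A v -> c <= dotp v w.
Proof.
move=> Aw; apply: smallest_sub => // x y l; rewrite !inE => cx cy /=.
change (c <= dotp (l%:num *: x + (1 - l%:num) *: y) w).
have l0 : 0 <= l%:num by [].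
have l1 : l%:num <= 1 by [].
have cxl := ler_wpM2l l0 cx.
have cyl : (1 - l%:num) * c <= (1 - l%:num) * dotp y w.
  by apply: ler_wpM2l cy; rewrite subr_ge0.
by rewrite dotpDl !dotpZl; lra.
Qed.

(** * Integrability of piecewise continuous functions *)

Definition scalar_piecewise_continuous (R : realType) (a b : R) (h : R -> R)
    : Prop :=
  [/\ exists2 S : set R, finite_set S &
        forall t, t \in `]a, b[ -> ~ S t -> {for t, continuous h},
      forall t, t \in `[a, b[ -> cvg (h @ t^'+) &
      forall t, t \in `]a, b] -> cvg (h @ t^'-)].

Lemma piecewise_continuous_coord (R : realType) (n : nat) (a b : R)
    (g : R -> 'rV[R]_n) (i : 'I_n) :
  piecewise_continuous a b g ->
  scalar_piecewise_continuous a b (fun t => g t ord0 i).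
Proof.
have coordc := @coord_continuous R 1 n ord0 i.
move=> [[S fS cg] rg lg]; split.
- exists S => // t tab St.
  exact: (continuous_comp (cg t tab St) (coordc (g t))).
- move=> t /rg /cvg_ex[l gl]; apply/cvg_ex; exists (l ord0 i).
  exact: (continuous_cvg _ (coordc l) gl).
- move=> t /lg /cvg_ex[l gl]; apply/cvg_ex; exists (l ord0 i).
  exact: (continuous_cvg _ (coordc l) gl).
Qed.

(** Apart from its two ends, the interval splits into a finite set, on which every function is
    measurable, and an open set on which [h] is continuous. *)
Lemma scalar_piecewise_continuous_measurable (R : realType) (a b : R)
    (h : R -> R) :
  scalar_piecewise_continuous a b h -> measurable_fun `[a, b] h.
Proof.
move=> [[S fS ch] _ _]; apply: (@measurable_fun_itv_cc _ _ _ false true).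
have mfin (F : set R) : finite_set F -> measurable F.
  move=> fF; apply: countable_measurable; last exact: finite_set_countable.
  by move=> x; exact: measurable_set1.
have oD : open (`]a, b[ `\` S).
  rewrite setDE; apply: openI; first exact: interval_open.
  rewrite openC; apply: accessible_finite_set_closed.1 fS.
  exact/hausdorff_accessible/Rhausdorff.
rewrite -[X in measurable_fun X](setUIDK _ S) measurable_funU; last 2 first.
- by apply: measurableI => //; apply: mfin.
- exact: open_measurable.
split; last first.
  apply: open_continuous_measurable_fun => // t.
  by rewrite inE => -[tab St]; exact: ch.
by move=> _ B _; apply: mfin; apply: sub_finite_set fS => x [[_ ?]].
Qed.

(** One-sided limits bound [h] on each side of every point; compactness of the interval makes these
    local bounds global. *)
Lemma scalar_piecewise_continuous_bounded (R : realType) (a b : R)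
    (h : R -> R) :
  scalar_piecewise_continuous a b h ->
  exists M, forall t, t \in `[a, b] -> `|h t| <= M.
Proof.
move=> [_ rh lh].
have locb (F : set_system R) : ProperFilter F -> cvg (h @ F) ->
    exists M, \forall t \near F, `|h t| <= M.
  move=> PF /cvg_ex[l hl]; exists (`|l| + 1).
  have h1 : \forall t \near F, `|l - h t| <= 1.
    by move/cvgrPdist_le : hl; apply.
  apply: filterS h1 => t; rewrite distrC => hlt.
  by rewrite -(subrK l (h t)) (le_trans (ler_normD _ _))// addrC lerD2l.
have loc t : t \in `[a, b] -> exists M, \forall t' \near t,
    t' \in `[a, b] -> `|h t'| <= M.
  move=> tab; have := tab; rewrite in_itv/= => /andP[at_ tb].
  have [M1 hM1] : exists M, \forall t' \near t,
      t < t' -> t' \in `[a, b] -> `|h t'| <= M.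
    (* At the end [b] no point of the interval lies to the right, so any bound will do; likewise to
       the left of [a] below. *)
    move: tb; rewrite le_eqVlt => /predU1P[->|tb].
      exists 0; apply: (@nearW _ (nbhs b)) => t' tt'.
      by rewrite in_itv/= => /andP[_]; rewrite leNgt tt'.
    have /locb[M hM] : cvg (h @ t^'+) by apply: rh; rewrite in_itv/= at_.
    by exists M; apply: filterS hM => t' hMt' _; exact: hMt'.
  have [M2 hM2] : exists M, \forall t' \near t,
      t' < t -> t' \in `[a, b] -> `|h t'| <= M.
    move: at_; rewrite le_eqVlt => /predU1P[<-|at_].
      exists 0; apply: (@nearW _ (nbhs a)) => t' tt'.
      by rewrite in_itv/= leNgt tt'.
    have /locb[M hM] : cvg (h @ t^'-) by apply: lh; rewrite in_itv/= at_.
    by exists M; apply: filterS hM => t' hMt' _; exact: hMt'.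
  (* One-sided limits say nothing about the value at [t] itself, hence the extra term. *)
  exists (Num.max `|h t| (Num.max M1 M2)).
  apply: filterS2 hM1 hM2 => t' h1 h2 t'ab; rewrite !le_max.
  have [tt'|t't|->] := ltgtP t t'; last by rewrite lexx.
  - by rewrite h1// !orbT.
  - by rewrite h2// !orbT.
(* Compactness in near-covering form: a bound that holds near each [t] for all large [M] holds on
   the whole interval for all large [M]. *)
have /compact_near_coveringP/near_covering_withinP cov :=
  @segment_compact R a b.
have [|M [Mr hM]] := cov _ (pinfty_nbhs R) (fun M t => `|h t| <= M) _.
  move=> t /loc[M hM].
  have hM2 : pinfty_nbhs R [set N | M <= N].
    exact/nbhs_pinfty_ge/num_real.
  exists ([set t' | t' \in `[a, b] -> `|h t'| <= M], [set N | M <= N]) => //=.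
  by move=> [t' N] [/= h1 h2] /h1 h3; exact: le_trans h2.
(* [hM] speaks of bounds strictly above [M]. *)
exists (M + 1) => t tab; apply: hM => //=.
by rewrite ltrDl.
Qed.

Lemma scalar_piecewise_continuous_integrable (R : realType) (a b : R)
    (h : R -> R) :
  scalar_piecewise_continuous a b h ->
  (@lebesgue_measure R).-integrable `[a, b] (EFin \o h).
Proof.
move=> pc; apply: measurable_bounded_integrable => //.
- exact/compact_finite_measure/segment_compact.
- exact: scalar_piecewise_continuous_measurable.
have [M hM] := scalar_piecewise_continuous_bounded pc.
exists M; split; rewrite ?num_real// => N MN t tab.
exact: le_trans (hM t tab) (ltW MN).
Qed.

(** * Fundamental theorem of calculus for piecewise derivatives *)

Lemma Rintegral_derive_oo (R : realType) (a b : R) (F h : R -> R) :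
  a < b -> {within `[a, b], continuous F} ->
  (forall t, t \in `]a, b[ -> {for t, continuous h}) ->
  (forall t, t \in `]a, b[ -> is_derive t 1 F (h t)) ->
  cvg (h @ a^'+) -> cvg (h @ b^'-) ->
  (@lebesgue_measure R).-integrable `[a, b] (EFin \o h) ->
  \int[lebesgue_measure]_(t in `[a, b]) h t = F b - F a.
Proof.
move=> ab cF ch dF /cvg_ex[/= la hla] /cvg_ex[/= lb hlb] ih.
(* The values of [h] at [a] and [b] are arbitrary: replace them by the limits. *)
pose h' t := if t == a then la else if t == b then lb else h t.
have h'E t : t \in `]a, b[ -> h' t = h t.
  by rewrite in_itv/= /h' => /andP[at_ tb]; rewrite gt_eqF// lt_eqF.
have ih' : {within `[a, b], continuous h'}.
  apply/continuous_within_itvP => //; split.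
  - move=> t tab; have := ch t tab.
    rewrite /prop_for/continuous_at (h'E _ tab); apply: cvg_trans.
    apply: near_eq_cvg; near=> u; rewrite h'E//.
    by near: u; exact: near_in_itvoo.
  - rewrite {2}/h' eqxx; apply: cvg_trans hla.
    apply: near_eq_cvg; near=> u; rewrite h'E// in_itv/=.
    by apply/andP; split; near: u; [exact: nbhs_right_gt|exact: nbhs_right_lt].
  - rewrite {2}/h' eqxx gt_eqF//; apply: cvg_trans hlb.
    apply: near_eq_cvg; near=> u; rewrite h'E// in_itv/=.
    by apply/andP; split; near: u; [exact: nbhs_left_gt|exact: nbhs_left_lt].
(* The ends are null sets, so passing from [h] to [h'] does not change the integral. *)
have oo (f : R -> R) : (@lebesgue_measure R).-integrable `[a, b] (EFin \o f) ->
    \int[lebesgue_measure]_(t in `[a, b]) f t =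
    \int[lebesgue_measure]_(t in `]a, b[) f t.
  move=> intf; rewrite Rintegral_itv_bndo_bndc; last first.
    apply: integrableS intf => // t /=.
    by rewrite !in_itv/= => /andP[/ltW-> /ltW->].
  rewrite Rintegral_itv_obnd_cbnd//.
  apply: integrableS intf => // t /=.
  by rewrite !in_itv/= => /andP[/ltW-> ->].
rewrite oo//; transitivity (\int[lebesgue_measure]_(t in `[a, b]) h' t).
  rewrite oo; last first.
    by apply: continuous_compact_integrable => //; exact: segment_compact.
  by apply: eq_Rintegral => t; rewrite inE/= => tab; rewrite h'E.
rewrite /Rintegral (@continuous_FTC2 _ h' F)//.
  have [_ Fa Fb] := (continuous_within_itvP _ ab).1 cF.
  by split=> // t /dF[].
by move=> t tab; rewrite derive1E h'E//; have [_ ->] := dF t tab.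
Unshelve. all: by end_near.
Qed.

(** Induction on the list [s] of exceptional times, for all intervals at once, cutting at the head
    of the list; [Rintegral_derive_oo] is the base case. *)
Lemma Rintegral_derive_piecewise (R : realType) (s : seq R) (a b : R)
    (F h : R -> R) :
  a < b -> {within `[a, b], continuous F} ->
  (forall t, t \in `]a, b[ -> t \notin s -> {for t, continuous h}) ->
  (forall t, t \in `]a, b[ -> t \notin s -> is_derive t 1 F (h t)) ->
  (forall t, t \in `[a, b[ -> cvg (h @ t^'+)) ->
  (forall t, t \in `]a, b] -> cvg (h @ t^'-)) ->
  (@lebesgue_measure R).-integrable `[a, b] (EFin \o h) ->
  \int[lebesgue_measure]_(t in `[a, b]) h t = F b - F a.
Proof.
elim: s a b => [|c s IH] a b ab cF ch dF rh lh ih.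
  apply: Rintegral_derive_oo => // [t tab|t tab||].
  - exact: ch.
  - exact: dF.
  - by apply: rh; rewrite in_itv/= lexx ab.
  - by apply: lh; rewrite in_itv/= lexx ab.
(* An exceptional time outside the open interval is simply dropped from the list. *)
have [cab|cab] := boolP (c \in `]a, b[); last first.
  by apply: IH => // t tab ts; [apply: ch|apply: dF] => //;
    rewrite inE negb_or ts andbT; apply: contraNneq cab => <-.
move: (cab); rewrite in_itv/= => /andP[ac cb].
(* After the cut [c] is no longer an interior point, so the induction hypothesis applies to each
   half with the shorter list. *)
have half (a' b' : R) : a' < b' -> a <= a' -> b' <= b -> c \notin `]a', b'[ ->
    \int[lebesgue_measure]_(t in `[a', b']) h t = F b' - F a'.
  move=> a'b' aa' b'b cab'.
  have sub b0 b1 (t : R) : t \in Interval (BSide b0 a') (BSide b1 b') ->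
      t \in Interval (BSide b0 a) (BSide b1 b).
    by apply: subitvP; rewrite /Order.le/= !bnd_simp aa' b'b.
  have subcc : `[a', b'] `<=` `[a, b] by move=> t /=; exact: sub.
  have tc (t : R) : t \in `]a', b'[ -> t != c.
    by move=> tab'; apply: contraNneq cab' => <-.
  have cF' := continuous_subspaceW subcc cF.
  have ch' t : t \in `]a', b'[ -> t \notin s -> {for t, continuous h}.
    by move=> tab' ts; apply: ch; rewrite ?sub// inE negb_or ts tc.
  have dF' t : t \in `]a', b'[ -> t \notin s -> is_derive t 1 F (h t).
    by move=> tab' ts; apply: dF; rewrite ?sub// inE negb_or ts tc.
  have ih' : (@lebesgue_measure R).-integrable `[a', b'] (EFin \o h).
    by apply: integrableS ih; [exact: measurable_itv..|exact: subcc].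
  have rh' t : t \in `[a', b'[ -> cvg (h @ t^'+) by move=> /sub; exact: rh.
  have lh' t : t \in `]a', b'] -> cvg (h @ t^'-) by move=> /sub; exact: lh.
  by rewrite (IH a' b' a'b' cF' ch' dF' rh' lh' ih').
have := @Rintegral_itvB _ h (BLeft a) (BRight b) c ih.
rewrite !bnd_simp (ltW ac) (ltW cb) => /(_ isT isT) intB.
rewrite -[LHS](subrK (\int[lebesgue_measure]_(t in `[a, c]) h t)) intB.
rewrite Rintegral_itv_obnd_cbnd; last first.
  apply: integrableS ih => //; apply: subset_itvr; rewrite bnd_simp. exact: ltW.
rewrite !half ?lexx ?(ltW ac) ?(ltW cb)//.
- by rewrite addrA subrK.
- by rewrite in_itv/= ltxx andbF.
- by rewrite in_itv/= ltxx.
Qed.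

(** Identifies the endpoint built from the derivative with the value of the trajectory at the final
    time. The exceptional times of the differentiation and of the continuity of [z] are merged into
    one list. *)
Lemma endpoint_derivative (R : realType) (n : nat) (a b : R)
    (x z : R -> 'rV[R]_n) :
  a < b -> piecewise_derivative a b x z -> endpoint a b (x a) z = x b.
Proof.
move=> ab [cx pcz [S fS dx]]; apply/rowP => i; rewrite !mxE.
have pci := piecewise_continuous_coord i pcz.
have [[S' fS' cz] rz lz] := pci.
have /finite_seqP[s SE] : finite_set (S `|` S') by rewrite finite_setU.
have notS t : t \notin s -> ~ S t /\ ~ S' t.
  by move=> ts; split=> [St|St]; move/negP: ts; apply;
    have : (S `|` S') t by [left|right]; rewrite SE.
pose xi t := x t ord0 i; pose zi t := z t ord0 i.
have cxi : {within `[a, b], continuous xi}.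
  move=> t.
  exact: (continuous_cvg _ (@coord_continuous R 1 n ord0 i (x t)) (cx t)).
have czi t : t \in `]a, b[ -> t \notin s -> {for t, continuous zi}.
  by move=> tab /notS[_ ?]; exact: cz.
have dxi t : t \in `]a, b[ -> t \notin s -> is_derive t 1 xi (zi t).
  move=> tab /notS[St _]; have [dxt xtE] := dx t tab St.
  split; first by move/derivable_mxP : dxt; exact.
  by rewrite /zi -xtE derive_mx// mxE.
have izi := scalar_piecewise_continuous_integrable pci.
by rewrite (Rintegral_derive_piecewise ab cxi czi dxi rz lz izi) addrC subrK.
Qed.

(** * Continuity of the endpoint in the L2 norm of the derivative *)

(** By contraposition: the power 1/2 is monotone, so a lower bound [e ^+ 2] on the integral gives
    the lower bound [e] on the norm. *)
Lemma L2norm_lt (R : realType) (n : nat) (a b e : R) (g : R -> 'rV[R]_n) :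
  0 < e -> (L2norm a b g < e%:E)%E ->
  (\int[lebesgue_measure]_(t in `[a, b]) (enorm (g t) ^+ 2)%:E < (e ^+ 2)%:E)%E.
Proof.
move=> e0; rewrite /L2norm unlock /= [X in _ -> (X < _)%E]integral_mkcond.
(* Extension by 0 outside the interval commutes with squaring. *)
rewrite (_ : (fun t => _ `^ 2)%E =
    (fun t => (enorm (g t) ^+ 2)%:E) \_ `[a, b]); last first.
  apply/funext => t; rewrite !patchE; case: ifPn => _.
    by rewrite poweR_EFin ger0_norm ?enorm_ge0// powR_mulrn// enorm_ge0.
  by rewrite abse0 poweR_EFin powR0.
apply: contraTT; rewrite -!leNgt => le_e.
have -> : e%:E = ((e ^+ 2)%:E `^ 2^-1)%E.
  by rewrite poweR_EFin -powR_mulrn ?(ltW e0)// -powRrM divff// powRr1 ?ltW.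
apply: gt0_ler_poweR => //.
- by rewrite in_itv/= leey andbT lee_fin sqr_ge0.
- rewrite in_itv/= leey andbT; apply: integral_ge0 => t _.
  by rewrite /patch; case: ifPn => // _; rewrite lee_fin sqr_ge0.
Qed.

Lemma scalar_piecewise_continuousB (R : realType) (a b : R) (g h : R -> R) :
  scalar_piecewise_continuous a b g -> scalar_piecewise_continuous a b h ->
  scalar_piecewise_continuous a b (fun t => g t - h t).
Proof.
move=> [[S fS cg] rg lg] [[S' fS' ch] rh lh]; split.
- exists (S `|` S'); first by rewrite finite_setU.
  move=> t tab SS't; apply: cvgB.
    by apply: cg => // St; apply: SS't; left.
  by apply: ch => // St; apply: SS't; right.
- by move=> t tab; apply: is_cvgB; [exact: rg|exact: rh].
- by move=> t tab; apply: is_cvgB; [exact: lg|exact: lh].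
Qed.

(** AM-GM with weight [e] does the work of Cauchy-Schwarz: the squared term integrates to less than
    [e / 2], the constant one to [e / 2 * (b - a)]. *)
Lemma endpoint_dist (R : realType) (n : nat) (a b e : R) (x0 : 'rV[R]_n)
    (z w : R -> 'rV[R]_n) (i : 'I_n) :
  a < b -> 0 < e -> piecewise_continuous a b z -> piecewise_continuous a b w ->
  (L2norm a b (z \- w)%R < e%:E)%E ->
  `|endpoint a b x0 z ord0 i - endpoint a b x0 w ord0 i| < e * (1 + (b - a)) / 2.
Proof.
move=> ab e0 pz pw /(L2norm_lt e0) zwe.
have pzj j := piecewise_continuous_coord j pz.
have pwj j := piecewise_continuous_coord j pw.
have intj j := scalar_piecewise_continuous_integrable
  (scalar_piecewise_continuousB (pzj j) (pwj j)).
have mj j : measurable_fun `[a, b] (fun t => z t ord0 j - w t ord0 j).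
  apply: scalar_piecewise_continuous_measurable.
  exact: scalar_piecewise_continuousB.
rewrite !mxE opprD addrACA subrr add0r -RintegralB//; last 2 first.
- exact: scalar_piecewise_continuous_integrable.
- exact: scalar_piecewise_continuous_integrable.
pose q t := enorm ((z \- w)%R t) ^+ 2.
have mq : measurable_fun `[a, b] q.
  rewrite (_ : q = fun t => \sum_j (z t ord0 j - w t ord0 j) ^+ 2).
    by apply: measurable_sum => j; exact: measurable_funX.
  apply/funext => t; rewrite /q enorm_sqr; apply: eq_bigr => j _.
  by rewrite !mxE.
have ie : 0 <= (2 * e)^-1 by rewrite invr_ge0 mulr_ge0// ltW.
(* AM-GM: [|h| <= (|h|^2 / e + e) / 2] *)
have hq t : `|z t ord0 i - w t ord0 i| <= (2 * e)^-1 * q t + e / 2.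
  set h := `|_|.
  have hle : h ^+ 2 <= q t.
    have := le_coord_enorm ((z \- w)%R t) i; rewrite !mxE -/h => hle.
    by rewrite /q ler_pXn2r ?nnegrE ?enorm_ge0 ?normr_ge0.
  apply: (@le_trans _ _ ((2 * e)^-1 * h ^+ 2 + e / 2)); last first.
    by rewrite lerD2r ler_wpM2l.
  rewrite -subr_ge0.
  rewrite (_ : _ - _ = (2 * e)^-1 * (h - e) ^+ 2); last by field; lra.
  by rewrite mulr_ge0// sqr_ge0.
apply: le_lt_trans (le_normr_Rintegral _ (intj i)) _ => //.
rewrite /Rintegral -lte_fin fineK; last first.
  by apply: integrable_fin_num => //; exact: (integrable_abse (intj i)).
have mcq : measurable_fun `[a, b] (fun t => ((2 * e)^-1)%:E * (q t)%:E)%E.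
  by apply: measurable_funeM; exact/measurable_EFinP.
have q0 t : 0 <= q t by rewrite /q sqr_ge0.
apply: (@le_lt_trans _ _ (\int[lebesgue_measure]_(t in `[a, b])
    (((2 * e)^-1)%:E * (q t)%:E + (e / 2)%:E))%E).
  apply: ge0_le_integral => //=.
  - by have /integrableP[] := integrable_abse (intj i).
  - exact: emeasurable_funD.
  - by move=> t _; rewrite -EFinM -EFinD lee_fin hq.
rewrite ge0_integralD//=; last 2 first.
- by move=> t _; rewrite -EFinM lee_fin mulr_ge0.
- by move=> t _; rewrite lee_fin divr_ge0// ltW.
rewrite ge0_integralZl_EFin//; last 2 first.
- by move=> t _; rewrite lee_fin.
- exact/measurable_EFinP.
rewrite integral_cst//= lebesgue_measure_itv/= lte_fin ab -EFinB -EFinM.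
apply: (@lt_le_trans _ _ (((2 * e)^-1)%:E * (e ^+ 2)%:E + (e / 2 * (b - a))%:E)%E).
  by rewrite lteD2rE// lte_pmul2l// lte_fin invr_gt0 mulr_gt0.
rewrite -EFinM -EFinD lee_fin.
suff -> : (2 * e)^-1 * e ^+ 2 + e / 2 * (b - a) = e * (1 + (b - a)) / 2 by [].
by field; lra.
Qed.

(** * Continuity of the spatial gradients *)

(** Links the partial derivatives that make up [grad_x] to the total differential, whose continuity
    [C1] provides. *)
Lemma dotp_grad_x (R : realType) (n : nat) (F : 'rV[R]_n * R -> R)
    (x w : 'rV[R]_n) (t : R) :
  differentiable F (x, t) -> dotp (grad_x F x t) w = 'd F (x, t) (w, 0).
Proof.
move=> dF.
(* Both sides are limits of the same difference quotients: moving along [(v, 0)] keeps the time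
   fixed. *)
have pderiv v : 'D_v (fun y => F (y, t)) x = 'd F (x, t) (v, 0).
  rewrite -deriveE// /derive; apply: (congr1 (fun f => lim (f @ 0^'))).
  apply/funext => h /=; congr (_ *: (F (_, _) - _)).
  by change (t = h * 0 + t); rewrite mulr0 add0r.
pose D v := 'd F (x, t) (v, 0).
have DD : {morph D : u v / u + v}.
  by move=> u v; rewrite /D -linearD; congr ('d F _ (_, _)); rewrite addr0.
have D0 : D 0 = 0 by exact: linear0.
have DZ a v : D (a *: v) = a *: D v.
  by rewrite /D -linearZ; congr ('d F _ (_, _)); rewrite scaler0.
rewrite -/(D w) [in RHS](row_sum_delta w) (big_morph D DD D0).
apply: eq_bigr => i _.
by rewrite mxE pderiv DZ mulrC.
Qed.

Lemma continuous_dotp_grad_x (R : realType) (n : nat) (F : 'rV[R]_n * R -> R)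
    (t : R) (w : 'rV[R]_n) :
  C1 F -> continuous (fun x => dotp (grad_x F x t) w).
Proof.
move=> [dF cdF] x.
rewrite (_ : (fun x => _) = (fun x => 'd F (x, t) (w, 0))); last first.
  by apply/funext => y; rewrite dotp_grad_x.
apply: (@continuous_comp _ _ _ (fun y => (y, t)) (fun p => 'd F p (w, 0))).
  exact: (@cvg_pair _ _ _ (nbhs x) (nbhs x) (nbhs t) _ _ _ id _ cvg_id (cvg_cst t)).
exact: cdF.
Qed.

(** * Lower bound on the distance to 0 *)

(** The exact duality part contributes [s k ^+ 2 = 1], and the [#|E|] errors sum to at most 1/2. For
    [l] other than [k] only [|s l| <= 1] is asked, since the sign of an inactive constraint may be
    0. *)
Lemma signed_combination_dotp (R : realType) (n : nat) (E : finType)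
    (g d : E -> 'rV[R]_n) (s : E -> R) (k : E) :
  (forall l, `|s l| <= 1) -> s k ^+ 2 = 1 ->
  (forall l, `|dotp (g k) (d l) - (k == l)%:R| <= (2 * #|E|%:R)^-1) ->
  1 / 2 <= dotp (s k *: g k) (\sum_l s l *: d l).
Proof.
move=> s1 sk gd.
rewrite dotpZl dotp_sumr mulr_sumr.
pose r l := s k * (s l * (dotp (g k) (d l) - (k == l)%:R)).
have -> : \sum_l s k * (s l * dotp (g k) (d l)) = 1 + \sum_l r l.
  have -> : 1 = \sum_l s k * (s l * (k == l)%:R).
    rewrite (bigD1 k)//= eqxx mulr1 -expr2 sk big1 ?addr0// => l lk.
    by rewrite eq_sym (negbTE lk) !mulr0.
  by rewrite -big_split; apply: eq_bigr => l _ /=; rewrite /r; ring.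
have E0 : (0 < #|E|)%N by apply/card_gt0P; exists k.
have : `|\sum_l r l| <= 1 / 2.
  apply: le_trans (ler_norm_sum _ _ _) _.
  apply: (@le_trans _ _ (\sum_(l : E) (2 * #|E|%:R)^-1)).
    apply: ler_sum => l _; rewrite /r mulrA !normrM -[leRHS]mul1r.
    by rewrite ler_pM ?mulr_ge0// mulr_ile1.
  rewrite sumr_const -[_ *+ _]mulr_natr invfM -mulrA mulVf ?mulr1 ?div1r//.
  by rewrite pnatr_eq0 -lt0n.
by rewrite ler_norml => /andP[? _]; lra.
Qed.

(** Every [v] in the hull satisfies [c <= dotp v w <= enorm v * M]. Nonemptiness matters because
    [inf] of the empty set is 0 by convention. *)
Lemma euclid_dist_convex_hull_ge (R : realType) (n : nat) (A : set 'rV[R]_n)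
    (w : 'rV[R]_n) (c M : R) :
  A !=set0 -> 0 < M -> \sum_(i < n) `|w ord0 i| <= M ->
  (forall v, A v -> c <= dotp v w) ->
  c / M <= euclid_dist 0 (convex_hull A).
Proof.
move=> [v0 Av0] M0 wM Aw; apply: lb_le_inf.
  by exists (enorm (v0 - 0)), v0 => //; exact: sub_gen_smallest.
move=> _ [v /(convex_hull_halfspace Aw) cv <-]; rewrite subr0.
rewrite ler_pdivrMr// (le_trans cv)// (le_trans (dotp_le_enorm _ _))//.
by rewrite ler_wpM2l// enorm_ge0.
Qed.

(** * Choice of the neighborhood and of the constant *)

Theorem lemma1 (R : realType) (n m : nat) (V : set 'rV[R]_m) (t0 T : R)
    (x0 : 'rV[R]_n) (f : 'rV[R]_n -> 'rV[R]_m -> R -> 'rV[R]_n)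
    (E : finType) (Phi0 : 'rV[R]_n * R -> R) (Phi : E -> 'rV[R]_n * R -> R)
    (xs zs : R -> 'rV[R]_n) (us : R -> 'rV[R]_m)
    (t0T : t0 < T) (E_neq0 : (0 < #|E|)%N)
    (compactV : compact V)
    (f_regular : regular_dynamics V t0 T f)
    (Phi0_C1 : C1 Phi0) (Phi_C1 : forall k, C1 (Phi k))
    (xs_us_optimal : optimal V t0 T x0 f Phi0 Phi xs us)
    (zs_derivative : piecewise_derivative t0 T xs zs)
    (LICQ : free [seq grad_x (Phi k) (xs T) T | k : E]) :
  exists (B : set ((R -> 'rV[R]_n) * (R -> 'rV[R]_m))) (a : R),
    [/\ L2_neighborhood V t0 T (zs, us) B,
        0 < a &
        forall z u, B (z, u) -> 0 < phi_term t0 T x0 Phi z ->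
          a <= euclid_dist 0 (subdiff_phi_term t0 T x0 Phi z)].
Proof.
have [[_ xs0 _ _] _] := xs_us_optimal; have [_ pzs _] := zs_derivative.
have [d gd] := dual_family LICQ.
(* The tolerance allowed by [signed_combination_dotp]. *)
pose eta : R := (2 * #|E|%:R)^-1.
have eta0 : 0 < eta by rewrite invr_gt0 mulr_gt0// ltr0n.
pose close (kl : E * E) x : Prop :=
  `|dotp (grad_x (Phi kl.1) x T) (d kl.2) - (kl.1 == kl.2)%:R| <= eta.
have near_close kl : \forall x \near xs T, close kl x.
  rewrite /close -gd.
  have := @continuous_dotp_grad_x _ _ _ T (d kl.2) (Phi_C1 kl.1) (xs T).
  by move/cvgrPdist_le => /(_ eta eta0); apply: filterS => x; rewrite distrC.
(* There are finitely many pairs of indices, so one radius serves them all. *)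
have [del /= del0 near_grad] := (nbhs_ballP (xs T) _).1
  (@filter_forall _ _ close (nbhs (xs T)) _ near_close).
have T1 : 0 < 1 + (T - t0) by rewrite addr_gt0// subr_gt0.
(* With this [e], [endpoint_dist] keeps each coordinate of the endpoint within [del / 2] of the
   optimal one. *)
pose e := del / (1 + (T - t0)).
have e0 : 0 < e by rewrite divr_gt0.
(* Bounds the l1 norm of [\sum_l s l *: d l] for all signs [s]; the summand 1 ensures positivity. *)
pose M := 1 + \sum_i \sum_l `|d l ord0 i|.
have M0 : 0 < M.
  by rewrite ltr_pwDl// sumr_ge0// => i _; rewrite sumr_ge0.
exists [set w | pair_space V t0 T w /\ (L2norm t0 T (w.1 \- zs)%R < e%:E)%E].
exists (1 / 2 / M); split.
- by split=> [w []//|]; exists e.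
- by rewrite divr_gt0.
move=> z u [[/= pz _] zzs] phi0.
set x := endpoint t0 T x0 z in near_grad *.
pose s k := Num.sg (Phi k (x, T)).
have grad_close k l : `|dotp (grad_x (Phi k) x T) (d l) - (k == l)%:R| <= eta.
  (* Balls of row vectors are coordinatewise, which is the form of [endpoint_dist]. *)
  apply: (near_grad x _ (k, l)); split=> // i j; rewrite (ord1 i).
  rewrite /ball/= -(endpoint_derivative t0T zs_derivative) xs0 distrC.
  apply: lt_trans (endpoint_dist x0 j t0T e0 pz pzs zzs) _.
  by rewrite /e divfK ?gt_eqF// ltr_pdivrMr// ltr_pMr// ltr1n.
apply: (@euclid_dist_convex_hull_ge _ _ _ (\sum_l s l *: d l)) => //.
(* Some constraint is active: the maximum over a nonempty [E] of nonnegative terms is attained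
   despite the base value 0. *)
- have /card_gt0P[k0 _] := E_neq0.
  have [k _ kE] := @eq_bigmax _ _ E 0 k0 predT
    (fun k => `|Phi k (x, T)|) isT (fun k _ => normr_ge0 _).
  by exists (s k *: grad_x (Phi k) x T), k.
- rewrite /M -[leLHS]add0r lerD// ler_sum// => i _.
  rewrite summxE (le_trans (ler_norm_sum _ _ _))// ler_sum// => l _.
  by rewrite mxE normrM ler_piMl// normr_sg lern1 leq_b1.
move=> _ [k /= kact <-].
rewrite -/x -/(s k).
apply: (@signed_combination_dotp _ _ _ (fun k => grad_x (Phi k) x T) d s k) => // [l|].
  by rewrite normr_sg lern1 leq_b1.
(* An active constraint has absolute value [phi_term], which is positive, so its sign is 1 or -1. *)
by rewrite sqr_sg -normr_gt0 kact phi0.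
Qed.
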